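(* Let $X$ be a Banach space and let $T:X\to X$ be a bounded linear operator. The following are equivalent: (i) $T$ is Li-Yorke chaotic. (ii) $T$ satisfies the Li-Yorke Chaos Criterion.
   Context: The operator $T$ is Li-Yorke chaotic if there is an uncountable subset $\Gamma\subset X$ such that for all distinct $x,y\in\Gamma$ one has $\liminf_{n\to\infty}\|T^nx-T^ny\|=0$ and $\limsup_{n\to\infty}\|T^nx-T^ny\|>0$. The operator $T$ satisfies the Li-Yorke Chaos Criterion if there exist a (strictly) increasing sequence of positive integers $(n_k)_k$ and a subset $X_0\subset X$ such that (a) $\lim_{k\to\infty}T^{n_k}x=0$ for every $x\in X_0$, and (b) $\sup_n\|T^n|_Y\|=\infty$, where $Y:=\overline{\operatorname{span}(X_0)}$ and $T^n|_Y:Y\to X$ denotes the restriction of $T^n$ to $Y$. *)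

(* Defs.v *)
From mathcomp Require Import all_boot all_order all_algebra.
From mathcomp Require Import complex.
From mathcomp Require Import all_classical all_reals all_analysis.

Set Implicit Arguments.
Unset Strict Implicit.
Unset Printing Implicit Defensive.

Import Order.TTheory GRing.Theory Num.Theory.
Import numFieldNormedType.Exports.

Local Open Scope classical_set_scope.
Local Open Scope ring_scope.

(* The norm of a normedModType K takes its values in the scalar field K.  For
   the real limits and suprema below, it is read in R through [re : K -> R],
   which is meant to be the identity when K = R and the real part when
   K = R[i]. *)
Definition rnorm (R : realType) (K : numFieldType) (re : K -> R)
  (X : normedModType K) (x : X) : R := re `|x|.

Definition bounded_operator (R : realType) (K : numFieldType) (re : K -> R)
    (X : normedModType K) (T : X -> X) : Prop :=
  exists M : R, forall x : X, rnorm re (T x) <= M * rnorm re x.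

Definition li_yorke_chaotic (R : realType) (K : numFieldType) (re : K -> R)
    (X : normedModType K) (T : X -> X) : Prop :=
  exists Gamma : set X, ~ countable Gamma /\
    forall x y : X, Gamma x -> Gamma y -> x <> y ->
      (limn_einf (fun n => (rnorm re (iter n T x - iter n T y))%:E) = 0)%E /\
      (0 < limn_esup (fun n => (rnorm re (iter n T x - iter n T y))%:E))%E.

Definition linear_span (K : numFieldType) (X : normedModType K)
    (A : set X) : set X :=
  [set y | exists (n : nat) (a : 'I_n -> K) (x : 'I_n -> X),
     (forall i, A (x i)) /\ y = \sum_(i < n) a i *: x i].

(* Norm of the restriction to Y of the linear map S, allowed to be +oo;
   here Y is a linear subspace. *)
Definition restr_opnorm (R : realType) (K : numFieldType) (re : K -> R)
    (X : normedModType K) (S : X -> X) (Y : set X) : \bar R :=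
  ereal_sup [set (rnorm re (S y))%:E | y in [set y | Y y /\ rnorm re y <= 1]].

Definition li_yorke_criterion (R : realType) (K : numFieldType) (re : K -> R)
    (X : normedModType K) (T : X -> X) : Prop :=
  exists (n_ : nat -> nat) (X0 : set X),
    [/\ {homo n_ : j k / (j < k)%N},
        forall k, (0 < n_ k)%N,
        forall x, X0 x -> (fun k => iter (n_ k) T x) @ \oo --> (0 : X) &
        ereal_sup (range (fun n : nat =>
          restr_opnorm re (iter n T) (closure (linear_span X0)))) = +oo%E].

(* Main.v *)
Require Import Defs.
From mathcomp Require Import all_boot all_order all_algebra.
From mathcomp Require Import complex.
From mathcomp Require Import all_classical all_reals all_analysis.
From mathcomp Require Import lra.

(** From a Li-Yorke chaotic operator, take two distinct points of the scrambled
set.  Their difference [u] is semi-irregular: its orbit comes arbitrarily close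
to [0] without converging to [0] ([chaotic_semi_irregular]).  Along a
subsequence [T^(n_k) u -> 0], hence by continuity also
[T^(n_k) (T^j u) -> 0] for all [j], and the criterion is tested on the orbit of
[u].  If the powers of [T] were bounded by [B] on the closed span of this
orbit, then [|T^n u| <= B |T^(n_k) u|] for all [n >= n_k], so that [T^n u]
would converge to [0] ([chaotic_criterion]).

Conversely, suppose that the criterion holds, and let [S] be the linear span of
[X0].  A Baire category argument in the closure of [S] gives an irregular
vector, whose orbit is unbounded and also comes arbitrarily close to [0]
([exists_irregular_vector]).  Both properties are countable intersections of
open conditions.  Each open condition is dense: every vector of [S] has an
orbit with arbitrarily small terms, and since the powers of [T] are not
uniformly bounded on [S], an arbitrarily small perturbation within [S] turns
any vector of [S] into one whose orbit has a large term.  All differences of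
points on the real line through an irregular vector [u] are multiples of [u],
so this line is an uncountable scrambled set ([irregular_li_yorke_chaotic]).

The real and the complex case are treated together, over a scalar field [K]
with an embedding of the reals that inverts the reading [re : K -> R] of
nonnegative scalars ([real_part]). *)

Set Implicit Arguments.
Unset Strict Implicit.
Unset Printing Implicit Defensive.

Import Order.TTheory GRing.Theory Num.Theory.
Import numFieldNormedType.Exports.

Local Open Scope classical_set_scope.
Local Open Scope ring_scope.

(** * Real-valued norms over a real or complex scalar field *)

Section ScalarField.
Context (R : realType) (K : numFieldType).

(** What the real and the complex scalars have in common here: [K] contains an
ordered copy of [R], to which every [k >= 0], hence every norm, belongs.  Then
[rnorm re] satisfies the axioms of a real-valued norm. *)
Record real_part (re : K -> R) (iota : {rmorphism R -> K}) : Prop := RealPart {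
  real_partK : cancel iota re;
  real_part_ge0K : forall k : K, 0 <= k -> iota (re k) = k;
  real_part_mono : {mono iota : a b / a <= b} }.

Context {re : K -> R} {iota : {rmorphism R -> K}} (reP : real_part re iota).
Context {X : normedModType K}.
Implicit Types x y : X.

Local Notation N := (rnorm re).

Lemma iota_rnorm x : iota (N x) = `|x|.
Proof. by rewrite /rnorm (real_part_ge0K reP). Qed.

Lemma rnorm_ge0 x : 0 <= N x.
Proof. by rewrite -(real_part_mono reP) iota_rnorm rmorph0. Qed.

Lemma rnorm0 : N (0 : X) = 0.
Proof. by rewrite /rnorm normr0 -(rmorph0 iota) (real_partK reP). Qed.

Lemma rnorm_gt0 x : x != 0 -> 0 < N x.
Proof.
move=> x0; rewrite lt_def rnorm_ge0 andbT; apply/eqP => Nx0.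
by move: x0; rewrite -normr_eq0 -iota_rnorm Nx0 rmorph0 eqxx.
Qed.

Lemma rnormN x : N (- x) = N x.
Proof. by rewrite /rnorm normrN. Qed.

Lemma rnormD x y : N (x + y) <= N x + N y.
Proof. by rewrite -(real_part_mono reP) rmorphD /= !iota_rnorm ler_normD. Qed.

Lemma rnormB x y : N (x - y) <= N x + N y.
Proof. by rewrite -[N y]rnormN rnormD. Qed.

Lemma rnormZ (a : R) x : N (iota a *: x) = `|a| * N x.
Proof.
have iota_norm : `|iota a| = iota `|a|.
  have [a0|/ltW a0] := leP 0 a.
    by rewrite !ger0_norm// -(rmorph0 iota) (real_part_mono reP).
  by rewrite !ler0_norm ?rmorphN// -(rmorph0 iota) (real_part_mono reP).
apply: (can_inj (real_partK reP)).
by rewrite iota_rnorm normrZ rmorphM /= iota_rnorm iota_norm.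
Qed.

Lemma norm_lt x (e : K) : 0 < e -> (`|x| < e) = (N x < re e).
Proof.
move=> e0; rewrite -[in LHS](real_part_ge0K reP (ltW e0)) -iota_rnorm.
exact: (leW_mono (real_part_mono reP)).
Qed.

Lemma re_gt0 (e : K) : 0 < e -> 0 < re e.
Proof.
move=> e0; rewrite -(leW_mono (real_part_mono reP)) rmorph0.
by rewrite (real_part_ge0K reP (ltW e0)).
Qed.

Lemma iota_gt0 (e : R) : 0 < e -> 0 < iota e.
Proof. by move=> e0; rewrite -(rmorph0 iota) (leW_mono (real_part_mono reP)). Qed.

(** Filters on [X] test neighbourhoods with radii in [K]; a positive radius
[e : K] is the image of the real [re e], so real radii suffice. *)
Lemma rnorm_cvgP (u : nat -> X) l :
  (u n @[n --> \oo] --> l) <->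
  forall e, 0 < e -> exists n0, forall n, (n0 <= n)%N -> N (l - u n) < e.
Proof.
split => [/cvgrPdist_lt ul e e0|ul].
  have [n0 _ un0] := ul _ (iota_gt0 e0).
  by exists n0 => n /un0 /=; rewrite norm_lt ?iota_gt0// (real_partK reP).
apply/cvgrPdist_lt => e e0; have [n0 un0] := ul _ (re_gt0 e0).
by exists n0 => // n /un0 /=; rewrite norm_lt.
Qed.

Lemma rnorm_closure (A : set X) x (e : R) :
  closure A x -> 0 < e -> exists2 y, A y & N (x - y) < e.
Proof.
move=> Ax e0.
have [y [Ay]] := Ax _ (nbhsx_ballx x _ (iota_gt0 e0)).
rewrite -ball_normE /= norm_lt ?iota_gt0// (real_partK reP) => xy.
by exists y.
Qed.

End ScalarField.

Lemma rnorm_complete (R : realType) (K : numFieldType) (re : K -> R)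
    (iota : {rmorphism R -> K}) (reP : real_part re iota)
    (X : completeNormedModType K) (u : nat -> X) :
  (forall e, 0 < e -> exists n0, forall n, (n0 <= n)%N ->
     rnorm re (u n0 - u n) < e) ->
  exists l : X, u n @[n --> \oo] --> l.
Proof.
move=> uC; apply/cvg_ex; apply/cauchy_cvgP; apply/cauchy_exP => e e0.
have [n0 un0] := uC _ (re_gt0 reP e0).
exists (u n0); exists n0 => // n /un0.
by rewrite /= -ball_normE /= (norm_lt reP).
Qed.

(** * Limits inferior and superior of real sequences *)

Section LimInfSup.
Context {R : realType}.
Implicit Type a : nat -> R.

Lemma limn_esupE (u : (\bar R)^nat) : limn_esup u = ereal_inf (range (esups u)).
Proof. by rewrite limn_esup_lim; apply/cvg_lim => //; exact: cvg_esups_inf. Qed.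

Lemma limn_einfE (u : (\bar R)^nat) : limn_einf u = ereal_sup (range (einfs u)).
Proof. by rewrite limn_einf_lim; apply/cvg_lim => //; exact: cvg_einfs_sup. Qed.

Lemma limn_einf_eq0P a : (forall n, 0 <= a n) ->
  (limn_einf (fun n => (a n)%:E) = 0)%E <->
  (forall e, 0 < e -> forall m, exists2 n, (m <= n)%N & a n < e).
Proof.
move=> a0; rewrite limn_einfE; split => [a_inf e e0 m|a_small].
  have : (einfs (fun n => (a n)%:E) m < e%:E)%E.
    apply: (@le_lt_trans _ _ 0%E); last by rewrite lte_fin.
    by rewrite -a_inf; apply: ereal_sup_ubound; exists m.
  by move=> /ereal_inf_ltP[_ [n /= mn <-]]; rewrite lte_fin; exists n.
apply/eqP; rewrite eq_le; apply/andP; split.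
  apply: ge_ereal_sup => _ [m _ <-]; apply/lee_addgt0Pr => e e0.
  have [n mn ane] := a_small _ e0 m.
  rewrite add0e; apply: le_trans (_ : _ <= (a n)%:E)%E _.
    by apply: ereal_inf_lbound; exists n.
  by rewrite lee_fin ltW.
apply: (@le_trans _ _ (einfs (fun n => (a n)%:E) 0)).
  by apply: le_ereal_inf_tmp => _ [n _ <-]; rewrite lee_fin.
by apply: ereal_sup_ubound; exists 0%N.
Qed.

Lemma limn_esup_gt0 a e : 0 < e -> (forall m, exists2 n, (m <= n)%N & e <= a n) ->
  (0 < limn_esup (fun n => (a n)%:E))%E.
Proof.
move=> e0 a_large; rewrite limn_esupE.
apply: (@lt_le_trans _ _ e%:E); first by rewrite lte_fin.
apply: le_ereal_inf_tmp => _ [m _ <-]; have [n mn ean] := a_large m.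
apply: le_trans (_ : _ <= (a n)%:E)%E _; first by rewrite lee_fin.
by apply: ereal_sup_ubound; exists n.
Qed.

Lemma limn_esup_le0 a :
  (forall e, 0 < e -> exists m, forall n, (m <= n)%N -> a n <= e) ->
  (limn_esup (fun n => (a n)%:E) <= 0)%E.
Proof.
move=> a_small; rewrite limn_esupE; apply/lee_addgt0Pr => e e0.
rewrite add0e; have [m am] := a_small _ e0.
apply: (@le_trans _ _ (esups (fun n => (a n)%:E) m)).
  by apply: ereal_inf_lbound; exists m.
by apply: ge_ereal_sup => _ [n /= mn <-]; rewrite lee_fin am.
Qed.

End LimInfSup.

(** A countable set is Lebesgue negligible, while [[0, 1]] has measure [1]. *)
Lemma setT_uncountable (R : realType) : ~ countable [set: R].
Proof.
move=> cR; have c01 : countable (`[0, 1]%classic : set R).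
  by apply: sub_countable cR; exact: subset_card_le.
have := countable_lebesgue_measure0 c01.
rewrite lebesgue_measure_itv /= lte01 => /eqP.
by rewrite sube0 onee_eq0.
Qed.

Lemma range_uncountable (R : realType) (T : Type) (f : R -> T) :
  injective f -> ~ countable (range f).
Proof.
move=> f_inj /countable_injP[g g_inj]; apply: (@setT_uncountable R).
apply/countable_injP; exists (g \o f) => a b _ _ gfab.
by apply: f_inj; apply: g_inj gfab; rewrite inE; eexists.
Qed.

(** * The two scalar fields *)

Lemma real_part_id (R : realType) : @real_part R R id idfun.
Proof. by split. Qed.

Lemma real_part_Re (R : realType) :
  @real_part R R[i] (@complex.Re R) (real_complex R).
Proof.
split => [//|[a b]|a b]; last by rewrite lecE /= eqxx.
by rewrite lecE /= => /andP[/eqP-> _].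
Qed.

(** * A Baire category argument *)

(** The Baire category theorem in the closure of [S], with the dense open sets
presented through their traces on [S]: each [P k] contains a closed ball centred
in [S] inside any given ball centred in [S].  Successive choices give nested
balls with radii tending to [0], and the limit of their centres lies in all of
them.  Since the centres stay in [S], completeness of [X] suffices and the
closure of [S] needs no normed structure of its own. *)
Lemma baire_closure (R : realType) (K : numFieldType) (re : K -> R)
    (iota : {rmorphism R -> K}) (reP : real_part re iota)
    (X : completeNormedModType K) (S : set X) (P : nat -> set X) :
  S !=set0 ->
  (forall k y (r : R), S y -> 0 < r -> exists y' (r' : R),
     [/\ S y', 0 < r', rnorm re (y - y') + r' <= r
       & forall z, rnorm re (y' - z) <= r' -> P k z]) ->
  exists u, forall k, P k u.
Proof.
move=> [y0 Sy0] step.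
(* A state is an index, a centre in S and a positive radius; the k-th step
   enters P k. *)
pose state := {s : nat * (X * R) | S s.2.1 /\ 0 < s.2.2}.
pose idx (s : state) := (sval s).1.
pose c (s : state) := (sval s).2.1.
pose r (s : state) := (sval s).2.2.
pose next (s s' : state) := [/\ idx s' = (idx s).+1,
  rnorm re (c s - c s') + r s' <= r s, r s' <= (idx s).+1%:R^-1
  & forall z, rnorm re (c s' - z) <= r s' -> P (idx s) z].
have next_total s : {s' | next s s'}.
  apply: cid; case: s => [[k [y e]] [/= Sy e0]].
  have [y' [e' [Sy' e'0 yy' Pe']]] := step k y e Sy e0.
  (* Shrinking the radius below 1/(k+1) makes the sequence of centres Cauchy. *)
  pose e'' := Num.min e' k.+1%:R^-1.
  have e''0 : 0 < e'' by rewrite /e'' lt_min e'0 invr_gt0 ltr0Sn.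
  have e''e' : e'' <= e' by rewrite ge_min lexx.
  exists (exist _ (k.+1, (y', e'')) (conj Sy' e''0)).
  split => //=; rewrite /c /r /idx /=.
  - by apply: le_trans yy'; rewrite lerD2l.
  - by rewrite ge_min lexx orbT.
  - by move=> z ze''; apply: Pe'; apply: le_trans e''e'.
pose s0 : state := exist _ (0%N, (y0, 1)) (conj Sy0 ltr01).
have [f [f0 fS]] := dependent_choice next_total s0.
have idxf n : idx (f n) = n.
  by elim: n => [|n IH]; [rewrite f0|have [-> _ _ _] := fS n; rewrite IH].
have r_ge0 n : 0 <= r (f n) by case: (svalP (f n)) => _ /ltW.
have nested k n : (k <= n)%N ->
    rnorm re (c (f k) - c (f n)) + r (f n) <= r (f k).
  elim: n => [|n IH]; rewrite ?leqn0.
    by move=> /eqP ->; rewrite subrr (rnorm0 reP) add0r.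
  rewrite leq_eqVlt => /predU1P[->|/IH {}IH].
    by rewrite subrr (rnorm0 reP) add0r.
  have [_ fn _ _] := fS n.
  apply: le_trans IH; rewrite -(subrKA (c (f n))).
  apply: le_trans (lerD (rnormD reP _ _) (lexx _)) _.
  by rewrite -addrA lerD2l.
have r_small e : 0 < e -> exists n, r (f n) < e.
  move=> e0; have [n _ nP] := near_infty_natSinv_lt (PosNum e0).
  have /= ne := nP n (leqnn n).
  exists n.+1; have [_ _ + _] := fS n; rewrite idxf => rn.
  exact: le_lt_trans ne.
have [l cl] : exists l : X, c (f n) @[n --> \oo] --> l.
  apply: (rnorm_complete (u := c \o f) reP) => e /r_small[n0 n0e].
  exists n0 => n /nested n0n; apply: le_lt_trans n0e.
  by apply: le_trans n0n; rewrite lerDl.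
exists l => k; have [_ _ _ +] := fS k; rewrite idxf => Pk; apply: Pk.
apply/ler_addgt0Pr => e e0.
have [n0 n0e] := (rnorm_cvgP reP _ _).1 cl e e0.
pose n := maxn n0 k.+1.
have := n0e n (leq_maxl _ _); have := nested _ n (leq_maxr _ _); have := r_ge0 n.
have := rnormD reP (c (f k.+1) - c (f n)) (c (f n) - l).
rewrite subrKA -[rnorm re (c (f n) - l)]rnormN opprB; lra.
Qed.

(** * Iterates of a bounded operator *)

Section Operator.
Context {R : realType} {K : numFieldType} {re : K -> R}
  {iota : {rmorphism R -> K}} (reP : real_part re iota).
Context {X : normedModType K} (T : {linear X -> X}).
Local Notation N := (rnorm re).

Lemma iter_linearD n x y : iter n T (x + y) = iter n T x + iter n T y.
Proof. by elim: n => //= n ->; rewrite linearD. Qed.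

Lemma iter_linearZ n a x : iter n T (a *: x) = a *: iter n T x.
Proof. by elim: n => //= n ->; rewrite linearZ. Qed.

Lemma iter_linearB n x y : iter n T (x - y) = iter n T x - iter n T y.
Proof. by rewrite iter_linearD -scaleN1r iter_linearZ scaleN1r. Qed.

Lemma iter_linear0 n : iter n T 0 = 0.
Proof. by elim: n => //= n ->; rewrite linear0. Qed.

(** If [C > 0] and [|T z| <= C |z|] for all [z], then [|T^n z| <= C^n |z|], so
[d = e / C^n] works. *)
Lemma iter_continuous n x e : bounded_operator re T -> 0 < e ->
  exists2 d, 0 < d & forall y, N (x - y) <= d -> N (iter n T x - iter n T y) <= e.
Proof.
move=> [M TM] e0; pose C := Num.max M 1.
have C1 : 1 <= C by rewrite le_max lexx orbT.
have C0 : 0 < C by apply: lt_le_trans C1.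
have iterC m z : N (iter m T z) <= C ^+ m * N z.
  elim: m => [|m IH]; first by rewrite expr0 mul1r.
  rewrite exprS -mulrA iterS; apply: le_trans (TM _) _.
  apply: le_trans (_ : C * N (iter m T z) <= _); last by rewrite ler_pM2l.
  by rewrite ler_wpM2r ?(rnorm_ge0 reP)// le_max lexx.
exists (e / C ^+ n) => [|y xy]; first by rewrite divr_gt0 ?exprn_gt0.
rewrite -iter_linearB; apply: le_trans (iterC _ _) _.
by rewrite mulrC -ler_pdivlMr ?exprn_gt0.
Qed.

Lemma sup_restr_opnormP (Y : set X) :
  ereal_sup (range (fun n => restr_opnorm re (iter n T) Y)) = +oo%E <->
  forall B, exists n y, [/\ Y y, N y <= 1 & B < N (iter n T y)].
Proof.
split=> [supy B|unbdd].
  have : (B%:E < ereal_sup (range (fun n => restr_opnorm re (iter n T) Y)))%E.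
    by rewrite supy ltry.
  move=> /ereal_sup_gtP[_ [n _ <-]] /ereal_sup_gtP[_ [y [Yy y1] <-]].
  by rewrite lte_fin => By; exists n, y.
apply: eq_infty => B; have [n [y [Yy y1 /ltW By]]] := unbdd B.
apply: (@le_trans _ _ (N (iter n T y))%:E); first by rewrite lee_fin.
apply: (@le_trans _ _ (restr_opnorm re (iter n T) Y)).
  by apply: ereal_sup_ubound; exists y.
by apply: ereal_sup_ubound; exists n.
Qed.

Lemma span_cvg0 (n_ : nat -> nat) (X0 : set X) :
  (forall x, X0 x -> iter (n_ k) T x @[k --> \oo] --> (0 : X)) ->
  forall x, linear_span X0 x -> iter (n_ k) T x @[k --> \oo] --> (0 : X).
Proof.
move=> X0cvg _ [n [a [x [X0x ->]]]].
elim/big_ind : _ => [|y z Ty Tz|i _].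
- under eq_fun do rewrite -(scale0r 0) iter_linearZ scale0r.
  exact: cvg_cst.
- under eq_fun do rewrite iter_linearD.
  by rewrite -(addr0 (0 : X)); exact: cvgD.
- under eq_fun do rewrite iter_linearZ.
  by rewrite -(scaler0 _ (a i)); apply: cvgZr; exact: X0cvg.
Qed.

Lemma linear_span_sub (X0 : set X) : X0 `<=` linear_span X0.
Proof.
move=> x X0x; exists 1%N, (fun=> 1), (fun=> x); split => //.
by rewrite big_ord1 scale1r.
Qed.

Lemma linear_span0 (X0 : set X) : linear_span X0 0.
Proof.
exists 0%N, (fun=> 0), (fun=> 0); split; first by case.
by rewrite big_ord0.
Qed.

Lemma linear_spanD (X0 : set X) x y :
  linear_span X0 x -> linear_span X0 y -> linear_span X0 (x + y).
Proof.
move=> [n [a [v [Av ->]]]] [m [b [w [Aw ->]]]].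
exists (n + m)%N.
exists (fun i => match fintype.split i with inl j => a j | inr j => b j end).
exists (fun i => match fintype.split i with inl j => v j | inr j => w j end).
split; first by move=> i; case: fintype.split.
rewrite big_split_ord /=; congr (_ + _); apply: eq_bigr => i _.
  by rewrite (unsplitK (inl i)).
by rewrite (unsplitK (inr i)).
Qed.

Lemma linear_spanZ (X0 : set X) c x :
  linear_span X0 x -> linear_span X0 (c *: x).
Proof.
move=> [n [a [v [Av ->]]]]; exists n, (fun i => c * a i), v; split => //.
by rewrite scaler_sumr; apply: eq_bigr => i _; rewrite scalerA.
Qed.

Lemma unbounded_closure (S : set X) :
  bounded_operator re T ->
  (forall a x, S x -> S (iota a *: x)) ->
  (forall B, exists n y, [/\ closure S y, N y <= 1 & B < N (iter n T y)]) ->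
  forall B, exists n y, [/\ S y, N y <= 1 & B < N (iter n T y)].
Proof.
move=> Tb SZ unbdd B; have [n [y [Sy y1 By]]] := unbdd (2 * B + 1).
have [d d0 yd] := iter_continuous n y Tb ltr01.
have d10 : 0 < Num.min d 1 by rewrite lt_min d0 ltr01.
have [z Sz] := rnorm_closure reP Sy d10.
rewrite lt_min => /andP[/ltW/yd Tyz yz1].
(* z is only known to have norm at most 2; halving it loses a factor 2 and the
   approximation loses 1, whence the bound 2 B + 1. *)
exists n, (iota 2^-1 *: z); split; first exact: SZ.
- rewrite (rnormZ reP) ger0_norm//.
  have := rnormB reP y (y - z); rewrite opprB addrC subrK; lra.
- rewrite iter_linearZ (rnormZ reP) ger0_norm//.
  have := rnormD reP (iter n T y - iter n T z) (iter n T z); rewrite subrK; lra.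
Qed.

(** The first [m] terms of the orbit are bounded by their sum. *)
Lemma orbit_escapes_inf_often x :
  (forall B, exists n, B < N (iter n T x)) ->
  forall B m, exists2 n, (m <= n)%N & B < N (iter n T x).
Proof.
move=> unbdd B m.
have [n] := unbdd (Num.max B (\sum_(i < m) N (iter i T x))).
rewrite gt_max => /andP[Bn sumn]; exists n => //.
rewrite leqNgt; apply/negP => nm; move: sumn; rewrite ltNge => /negP; apply.
rewrite (bigD1 (Ordinal nm)) //= lerDl.
by apply: sumr_ge0 => i _; exact: (rnorm_ge0 reP).
Qed.

End Operator.

(** * Irregular vectors *)

(** Vectors with an unbounded orbit that comes arbitrarily close to [0].  In the
condition [P k] of the Baire argument, the small term is required at a time
[m >= k], so that the conditions together give small terms at arbitrarily late
times. *)
Lemma exists_irregular_vector (R : realType) (K : numFieldType) (re : K -> R)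
    (iota : {rmorphism R -> K}) (reP : real_part re iota)
    (X : completeNormedModType K) (T : {linear X -> X}) (S : set X) :
  bounded_operator re T -> S !=set0 ->
  (forall x y, S x -> S y -> S (x + y)) ->
  (forall a x, S x -> S (iota a *: x)) ->
  (forall x, S x -> forall e, 0 < e ->
     forall m, exists2 n, (m <= n)%N & rnorm re (iter n T x) < e) ->
  (forall B, exists n x, [/\ S x, rnorm re x <= 1 & B < rnorm re (iter n T x)]) ->
  exists u : X,
    (forall e, 0 < e -> forall m, exists2 n, (m <= n)%N & rnorm re (iter n T u) < e) /\
    (forall B, exists n, B < rnorm re (iter n T u)).
Proof.
move=> Tb S0 SD SZ S_small unbdd.
pose P k : set X := [set x |
  (exists n, k%:R < rnorm re (iter n T x)) /\
  exists2 m, (k <= m)%N & rnorm re (iter m T x) < k.+1%:R^-1].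
have [k y r Sy r0|u Pu] := baire_closure (P := P) reP S0.
  have [n [z [Sz z1 Bz]]] := unbdd (2 * (k.+1%:R) / (r / 2)).
  have r20 : 0 < r / 2 by rewrite divr_gt0.
  pose w := iota (r / 2) *: z.
  have w_small : rnorm re w <= r / 2.
    by rewrite (rnormZ reP) gtr0_norm// ler_piMr// ltW.
  have w_large : 2 * k.+1%:R < rnorm re (iter n T w).
    by rewrite iter_linearZ (rnormZ reP) gtr0_norm// [ltRHS]mulrC -ltr_pdivrMr.
  (* As T^n w = T^n (y + w) - T^n y, one of y and y + w is sent by T^n to a
     vector of norm greater than k + 1. *)
  have [y' [Sy' yy' y'_large]] : exists y', [/\ S y', rnorm re (y - y') <= r / 2
      & k.+1%:R < rnorm re (iter n T y')].
    have [|yk] := ltP k.+1%:R (rnorm re (iter n T y)).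
      by exists y; split => //; rewrite subrr (rnorm0 reP) ltW.
    exists (y + w); split; [by apply: SD => //; exact: SZ| |].
      by rewrite opprD addNKr rnormN.
    have := rnormB reP (iter n T (y + w)) (iter n T y).
    rewrite iter_linearD [X in X - _]addrC addrK; lra.
  (* The surplus 1 above k and the factor 1/2 below 1/(k+1) leave room for a
     whole ball around y'. *)
  have e0 : 0 < k.+1%:R^-1 / 2 :> R by rewrite divr_gt0.
  have [m km my'] := S_small _ Sy' _ e0 k.
  have [d1 d10 y'd1] := iter_continuous reP n y' Tb ltr01.
  have [d2 d20 y'd2] := iter_continuous reP m y' Tb e0.
  exists y', (Num.min (r / 2) (Num.min d1 d2)); split => //.
  - by rewrite !lt_min r20 d10 d20.
  - rewrite [leRHS](splitr r) lerD// ge_min lexx//.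
  move=> v; rewrite !le_min => /and3P[_ /y'd1 Tn /y'd2 Tm]; split.
    exists n; have := rnormD reP (iter n T y' - iter n T v) (iter n T v).
    rewrite subrK; move: y'_large; rewrite -natr1; lra.
  exists m => //; have := rnormB reP (iter m T y') (iter m T y' - iter m T v).
  rewrite opprB addrC subrK; move: my' Tm; move: _^-1 => q; lra.
exists u; split => [e e0 m|B].
  have [k _ nP] := near_infty_natSinv_lt (PosNum e0).
  have [_ [n kn nk]] := Pu (maxn k m).
  exists n; first by apply: leq_trans kn; rewrite leq_maxr.
  apply: (lt_trans nk); exact: nP (leq_maxl _ _).
have [[n Bn] _] := Pu (Num.truncn B).+1; exists n; apply: le_lt_trans Bn.
by apply/ltW/truncnS_gt.
Qed.

(** * Li-Yorke chaos and the criterion *)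

Section Equivalence.
Context {R : realType} {K : numFieldType} {re : K -> R}
  {iota : {rmorphism R -> K}} (reP : real_part re iota).
Context {X : completeNormedModType K} {T : {linear X -> X}}.
Context (Tbounded : bounded_operator re T).
Local Notation N := (rnorm re).

(** The real line through [u] is scrambled, since the difference of the orbits of
[a u] and [b u] has norm [|a - b| |T^n u|]. *)
Lemma irregular_li_yorke_chaotic (u : X) :
  (forall e, 0 < e -> forall m, exists2 n, (m <= n)%N & N (iter n T u) < e) ->
  (forall B, exists n, B < N (iter n T u)) ->
  li_yorke_chaotic re T.
Proof.
move=> u_small u_large.
have u0 : u != 0.
  apply/eqP => u0; have [n] := u_large 0.
  by rewrite u0 iter_linear0 (rnorm0 reP) ltxx.
have Nline a b n : N (iter n T (iota a *: u) - iter n T (iota b *: u)) =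
    `|a - b| * N (iter n T u).
  by rewrite !iter_linearZ -scalerBl -rmorphB (rnormZ reP).
exists (range (fun a : R => iota a *: u)); split.
  apply: range_uncountable => a b ab.
  apply/eqP; rewrite -subr_eq0 -normr_eq0.
  have /eqP := Nline a b 0%N; rewrite /= ab subrr (rnorm0 reP) eq_sym mulf_eq0.
  by rewrite (gt_eqF (rnorm_gt0 reP u0)) orbF.
move=> _ _ [a _ <-] [b _ <-] ab.
have ab0 : 0 < `|a - b|.
  by rewrite normr_gt0 subr_eq0; apply/eqP => ab'; apply: ab; rewrite ab'.
split.
  apply/limn_einf_eq0P => [n|e e0 m]; first exact: (rnorm_ge0 reP).
  have [n mn ne] := u_small (e / `|a - b|) (divr_gt0 e0 ab0) m.
  by exists n => //; rewrite Nline mulrC -ltr_pdivlMr.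
apply: (limn_esup_gt0 (e := `|a - b|)) => // m.
have [n mn n1] := orbit_escapes_inf_often reP u_large 1 m.
by exists n => //; rewrite Nline ler_peMr ?ltW.
Qed.

(** The orbits of the vectors of the span tend to [0] along [n_], and the
unboundedness of the powers passes from the closed span to the span itself, so
[T] has an irregular vector. *)
Lemma criterion_chaotic : li_yorke_criterion re T -> li_yorke_chaotic re T.
Proof.
move=> [n_ [X0 [n_incr _ X0cvg /sup_restr_opnormP unbdd]]].
have [| | | | |u [u_small u_large]] :=
  exists_irregular_vector (S := linear_span X0) reP Tbounded.
- by exists 0; exact: linear_span0.
- exact: linear_spanD.
- by move=> a x; exact: linear_spanZ.
- move=> x /(span_cvg0 X0cvg)/(rnorm_cvgP reP) x_small e e0 m.
  have [k0 xk0] := x_small e e0.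
  exists (n_ (maxn k0 m)).
    apply: leq_trans (leq_maxr k0 m) _.
    elim: (maxn k0 m) => // k /leq_ltn_trans; apply; exact: n_incr.
  by rewrite -rnormN -sub0r; apply: xk0; exact: leq_maxl.
- apply: (unbounded_closure reP Tbounded) => // a x; exact: linear_spanZ.
exact: irregular_li_yorke_chaotic u_small u_large.
Qed.

(** An uncountable set has two distinct points, and by linearity their orbits
differ by the orbit of their difference. *)
Lemma chaotic_semi_irregular : li_yorke_chaotic re T -> exists u : X,
  (forall e, 0 < e -> forall m, exists2 n, (m <= n)%N & N (iter n T u) < e) /\
  (0 < limn_esup (fun n => (N (iter n T u))%:E))%E.
Proof.
move=> [Gamma [Gamma_unc LY]].
have [x [y [Gx Gy xy]]] : exists x y, [/\ Gamma x, Gamma y & x <> y].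
  apply: contrapT => Gamma1; apply: Gamma_unc.
  apply/countable_injP; exists (fun=> 0%N) => x y; rewrite !inE => Gx Gy _.
  by apply: contrapT => xy; apply: Gamma1; exists x, y.
have [] := LY x y Gx Gy xy; under eq_fun do rewrite -iter_linearB.
move=> /limn_einf_eq0P xy_small xy_large.
by exists (x - y); split => //; apply: xy_small => n; exact: (rnorm_ge0 reP).
Qed.

(** The criterion is tested on the orbit of a semi-irregular vector [u], and not
on [u] alone, so that the span contains the vectors [T^m u] at which a bound on
the powers of [T] is applied. *)
Lemma chaotic_criterion : li_yorke_chaotic re T -> li_yorke_criterion re T.
Proof.
move=> /chaotic_semi_irregular[u [u_small u_limsup]].
have next_ex (p : nat * nat) : exists n, (p.1 < n)%N /\ N (iter n T u) < p.2.+1%:R^-1.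
  have [|n] := u_small p.2.+1%:R^-1 _ p.1.+1; first by rewrite invr_gt0.
  by exists n.
have [next nextP] := choice next_ex.
pose n_ := fix n_ k := if k is j.+1 then next (n_ j, k) else next (0, 0)%N.
have n_small k : N (iter (n_ k) T u) < k.+1%:R^-1.
  by case: k => [|k]; exact: (nextP _).2.
have n_ltS k : (n_ k < n_ k.+1)%N by exact: (nextP (n_ k, k.+1)).1.
exists n_, (range (fun j => iter j T u)); split.
- exact: homo_ltn ltn_trans n_ltS.
- case=> [|k]; first exact: (nextP (0, 0)%N).1.
  by apply: leq_ltn_trans (n_ltS k).
- move=> _ [j _ <-]; apply/(rnorm_cvgP reP) => e e0.
  have e20 : 0 < e / 2 by rewrite divr_gt0.
  have [d d0 Td] := iter_continuous reP j 0 Tbounded e20.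
  have [k0 _ k0P] := near_infty_natSinv_lt (PosNum d0).
  exists k0 => k /k0P/= kd.
  rewrite -iterD addnC iterD -{1}(iter_linear0 T j).
  apply: (@le_lt_trans _ _ (e / 2)); last lra.
  by apply: Td; rewrite sub0r rnormN; apply/ltW/(lt_trans (n_small k)).
apply/sup_restr_opnormP; apply: contrapT => bdd.
have [B TB] : exists B : R, forall n y,
    closure (linear_span (range (fun j => iter j T u))) y -> N y <= 1 ->
    N (iter n T y) <= B.
  apply: contrapT => noB; apply: bdd => B.
  apply: contrapT => allB; apply: noB; exists B => n y Yy y1.
  by rewrite leNgt; apply/negP => By; apply: allB; exists n, y.
move: u_limsup; rewrite ltNge => /negP; apply.
(* Once |T^m u| < e / (|B| + 1), all later terms of the orbit are at most e. *)
apply: limn_esup_le0 => e e0.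
pose d := e / (`|B| + 1).
have B1 : 0 < `|B| + 1 by rewrite ltr_wpDl.
have d0 : 0 < d by rewrite divr_gt0.
have [m _ md] := u_small d d0 0%N.
exists m => n /subnK <-; rewrite iterD.
have := TB (n - m)%N (iota d^-1 *: iter m T u).
rewrite iter_linearZ !(rnormZ reP) gtr0_norm ?invr_gt0//.
rewrite ![d^-1 * _]mulrC !ler_pdivrMr// mul1r => TBm.
apply: (@le_trans _ _ (B * d)).
  apply: TBm; last exact: ltW.
  by apply/subset_closure/linear_spanZ/linear_span_sub; exists m.
rewrite /d mulrCA ger_pMr// ler_pdivrMr// mul1r.
by apply: le_trans (ler_norm B) _; rewrite lerDl.
Qed.

End Equivalence.

Theorem theorem8 (R : realType) :
  (forall (X : completeNormedModType R) (T : {linear X -> X}),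
     bounded_operator (@id R) T ->
     (li_yorke_chaotic (@id R) T <-> li_yorke_criterion (@id R) T)) /\
  (forall (X : completeNormedModType R[i]) (T : {linear X -> X}),
     bounded_operator (@complex.Re R) T ->
     (li_yorke_chaotic (@complex.Re R) T <->
      li_yorke_criterion (@complex.Re R) T)).
Proof.
split=> X T Tbounded; split.
- exact: (chaotic_criterion (real_part_id R) Tbounded).
- exact: (criterion_chaotic (real_part_id R) Tbounded).
- exact: (chaotic_criterion (real_part_Re R) Tbounded).
- exact: (criterion_chaotic (real_part_Re R) Tbounded).
Qed.
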